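(* Let $X$ be a nonempty finite or countably infinite set, let $\Lambda\subseteq X$, and let $c\ge 0$ and $w\ge 0$ be (real-valued) vectors indexed by $X$ that are strictly positive on $\Lambda$. Consider the following conditions on a matrix $\alpha=(\alpha_{xy})_{x,y\in X}$ with nonnegative real entries: (a) $\sum_{k=0}^\infty c(I_\Lambda\alpha I_\Lambda)^kw<\infty$. (b) For all $h\colon X\to[0,1]$ with $\operatorname{supp}h=\Lambda$ such that $h\ge\epsilon\chi_\Lambda$ for some $\epsilon>0$, we have $\sum_{k=0}^\infty c(I_\Lambda\beta_hI_\Lambda)^kw<\infty$. (b$'$) There exists $h\colon X\to[0,1]$ with $\operatorname{supp}h=\Lambda$ such that $\sum_{k=0}^\infty c(I_\Lambda\beta_hI_\Lambda)^kw<\infty$. (c) For every finite sequence $f_1,\ldots,f_m$ of functions $X\to[0,1]$ with $\operatorname{supp}(f_i)\subseteq\Lambda$ such that $\sum_if_i\ge\epsilon\chi_\Lambda$ for some $\epsilon>0$, we have $\sum_{k=0}^\infty c(I_\Lambda\beta_{f_1}\cdots\beta_{f_m}I_\Lambda)^kw<\infty$. (c$'$) There exists a finite sequence $f_1,\ldots,f_m$ of functions $X\to[0,1]$ with $\operatorname{supp}(f_i)\subseteq\Lambda$ such that $\sum_{k=0}^\infty c(I_\Lambda\beta_{f_1}\cdots\beta_{f_m}I_\Lambda)^kw<\infty$. (d) For every cloud $\nu\ge 0$ that is carried by $\Lambda$ and satisfies $|||\nu|||\le 1$ and $\nu((x))\le 1-\epsilon$ for every $x\in\Lambda$ (for some $\epsilon>0$),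 we have $\sum_{k=0}^\infty c(I_\Lambda T_\nu I_\Lambda)^kw<\infty$. (d$'$) There exists a cloud $\nu\in\mathcal S_1$ that is carried by $\Lambda$ and supported on finitely many levels, such that $\sum_{k=0}^\infty c(I_\Lambda T_\nu I_\Lambda)^kw<\infty$. Then (a) $\iff$ (b) $\iff$ (b$'$) $\iff$ (c) $\iff$ (d) $\Longrightarrow$ (c$'$) $\Longrightarrow$ (d$'$); and for matrices $\alpha$ satisfying the additional hypothesis that there exists a constant $C<\infty$ such that $I_\Lambda\alpha I_\Lambda w\le Cw$, all seven conditions are equivalent.
   Context: $c$ is a row vector and $w$ a column vector; all products and sums of nonnegative quantities are computed in $[0,+\infty]$ with $0\cdot\infty=0$. For $f\colon X\to\mathbb R$, $I_f$ is the diagonal matrix $(I_f)_{xy}=f(x)\delta_{xy}$; $I_\Lambda=I_{\chi_\Lambda}$ with $\chi_\Lambda$ the indicator function of $\Lambda$. A $0$-th power of a matrix is the identity matrix. For $f\colon X\to[0,1]$ the cleaning operator is $\beta_f=I_{1-f}+I_f\alpha$. $\operatorname{supp}f=\{x: f(x)\ne0\}$. No subinvariance condition (such as $\alpha w\le w$) is assumed. A marker is a nonempty finite sequence $\eta=(x_0,\ldots,x_k)$ of elements of $X$; its level is $k$. An ancestor of $\eta$ is any prefix $(x_0,\ldots,x_j)$, $0\le j\le k$; write $\sigma\preccurlyeq\eta$. A cloud is a real-valued function $\nu$ on the set of all markers; $\nu\ge0$ is pointwise. $\nu$ is supported on finitely many levels if there is $N$ with $\nu(\eta)=0$ whenever $\mathrm{level}(\eta)>N$.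 Put $|||\nu|||=\sup_\eta\sum_{\sigma\preccurlyeq\eta}|\nu(\sigma)|$ and $\widetilde\nu(\eta)=\sum_{\sigma\preccurlyeq\eta}\nu(\sigma)$. $\mathcal S_1$ is the class of clouds $\nu\ge 0$ such that $\sup_{\eta':\,\eta\preccurlyeq\eta'}\widetilde\nu(\eta')=1$ for every marker $\eta$. $\nu$ is carried by $\Lambda$ if $\nu(\eta)=0$ for every marker $\eta=(x_0,\ldots,x_k)$ having at least one index $j<k$ with $x_j\notin\Lambda$. For a nonnegative cloud $\nu$, $T_\nu=\sum_{\eta=(x_0,\ldots,x_k)}\nu(\eta)\,I_{\{x_0\}}\alpha I_{\{x_1\}}\alpha\cdots\alpha I_{\{x_k\}}$, i.e. $(T_\nu)_{xy}=\sum\nu(\eta)\,\alpha_{x_0x_1}\cdots\alpha_{x_{k-1}x_k}$ over markers with $x_0=x$, $x_k=y$; entries in $[0,+\infty]$. *)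

(* Defs.v *)
From HB Require Import structures.
From mathcomp Require Import all_boot all_order all_algebra.
From mathcomp Require Import all_classical all_reals all_analysis.
Set Implicit Arguments.
Unset Strict Implicit.
Unset Printing Implicit Defensive.
Import Order.TTheory GRing.Theory Num.Theory.
Local Open Scope classical_set_scope.
Local Open Scope ring_scope.
Local Open Scope ereal_scope.

(* Matrices over X with entries in \bar R.  They are only ever used with
   nonnegative entries, for which \esum is the sum in [0, +oo]; multiplication
   of \bar R satisfies 0 * +oo = 0. *)
Definition emx (R : realType) (X : countType) : Type := X -> X -> \bar R.

Definition emx_one (R : realType) (X : countType) : emx R X :=
  fun x y => ((x == y)%:R)%:E.

Definition emx_diag (R : realType) (X : countType) (f : X -> R) : emx R X :=
  fun x y => (f x *+ (x == y))%:E.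

Definition emx_of (R : realType) (X : countType) (a : X -> X -> R) : emx R X :=
  fun x y => (a x y)%:E.

Definition emx_add (R : realType) (X : countType) (A B : emx R X) : emx R X :=
  fun x y => A x y + B x y.

Definition emx_mul (R : realType) (X : countType) (A B : emx R X) : emx R X :=
  fun x y => \esum_(z in [set: X]) (A x z * B z y).

Definition emx_pow (R : realType) (X : countType) (A : emx R X) (k : nat) :
    emx R X :=
  iter k (emx_mul A) (@emx_one R X).

Definition emx_col (R : realType) (X : countType) (A : emx R X) (w : X -> R) :
    X -> \bar R :=
  fun x => \esum_(y in [set: X]) (A x y * (w y)%:E).

Definition row_col (R : realType) (X : countType) (c : X -> R)
    (v : X -> \bar R) : \bar R :=
  \esum_(x in [set: X]) ((c x)%:E * v x).

(* I_Lambda A I_Lambda *)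
Definition emx_restrict (R : realType) (X : countType) (Lambda : set X)
    (A : emx R X) : emx R X :=
  emx_mul (emx_mul (emx_diag \1_Lambda) A) (emx_diag \1_Lambda).

(* \sum_k c (I_Lambda A I_Lambda)^k w *)
Definition neumann_sum (R : realType) (X : countType) (Lambda : set X)
    (c w : X -> R) (A : emx R X) : \bar R :=
  \sum_(0 <= k <oo) row_col c (emx_col (emx_pow (emx_restrict Lambda A) k) w).

Definition unit_valued (R : realType) (X : countType) (f : X -> R) : Prop :=
  forall x, (0 <= f x <= 1)%R.

Definition fsupp (R : realType) (X : countType) (f : X -> R) : set X :=
  [set x | f x != 0%R].

Definition cleaning (R : realType) (X : countType) (alpha : X -> X -> R)
    (f : X -> R) : emx R X :=
  emx_add (emx_diag (fun x => 1 - f x)%R)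
          (emx_mul (emx_diag f) (emx_of alpha)).

(* beta_{f_1} ... beta_{f_m}, in this order; the identity if m = 0 *)
Definition cleaning_prod (R : realType) (X : countType) (alpha : X -> X -> R)
    (m : nat) (f : 'I_m -> X -> R) : emx R X :=
  \big[@emx_mul R X/@emx_one R X]_(i < m) cleaning alpha (f i).

(* The marker (x_0, ..., x_k) is encoded as (x_0, [:: x_1; ...; x_k]). *)
Definition marker (X : countType) : Type := (X * seq X)%type.

Definition level (X : countType) (eta : marker X) : nat := size eta.2.

(* x_j, for j <= level eta *)
Definition mnth (X : countType) (eta : marker X) (j : nat) : X :=
  nth eta.1 (eta.1 :: eta.2) j.

(* (x_0, ..., x_j), for j <= level eta *)
Definition mprefix (X : countType) (eta : marker X) (j : nat) : marker X :=
  (eta.1, take j eta.2).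

Definition ancestor (X : countType) (sigma eta : marker X) : Prop :=
  exists2 j : nat, (j <= level eta)%N & sigma = mprefix eta j.

Definition cloud (R : realType) (X : countType) : Type := marker X -> R.

(* The prefixes of eta of different levels are distinct, so summing over the
   level j is summing over the ancestors of eta. *)
Definition ancestor_sum (R : realType) (X : countType) (nu : cloud R X)
    (eta : marker X) : R :=
  (\sum_(0 <= j < (level eta).+1) nu (mprefix eta j))%R.

Definition cloud_ge0 (R : realType) (X : countType) (nu : cloud R X) : Prop :=
  forall eta, (0 <= nu eta)%R.

Definition cloud_norm (R : realType) (X : countType) (nu : cloud R X) :
    \bar R :=
  ereal_sup (range (fun eta : marker X =>
    (ancestor_sum (fun sigma => `|nu sigma|%R) eta)%:E)).

Definition finitely_many_levels (R : realType) (X : countType)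
    (nu : cloud R X) : Prop :=
  exists N : nat, forall eta, (N < level eta)%N -> nu eta = 0%R.

Definition cloud_S1 (R : realType) (X : countType) (nu : cloud R X) : Prop :=
  cloud_ge0 nu /\
  forall eta : marker X,
    ereal_sup [set (ancestor_sum nu eta')%:E
              | eta' in [set eta' | ancestor eta eta']] = 1.

Definition carried_by (R : realType) (X : countType) (Lambda : set X)
    (nu : cloud R X) : Prop :=
  forall eta : marker X,
    (exists2 j : nat, (j < level eta)%N & ~ Lambda (mnth eta j)) ->
    nu eta = 0%R.

(* alpha_{x_0 x_1} ... alpha_{x_{k-1} x_k} *)
Definition path_weight (R : realType) (X : countType) (alpha : X -> X -> R)
    (eta : marker X) : R :=
  (\prod_(0 <= j < level eta) alpha (mnth eta j) (mnth eta j.+1))%R.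

Definition cloud_mx (R : realType) (X : countType) (alpha : X -> X -> R)
    (nu : cloud R X) : emx R X :=
  fun x y => \esum_(eta in [set eta : marker X |
                 mnth eta 0 = x /\ mnth eta (level eta) = y])
               (nu eta * path_weight alpha eta)%:E.

Definition cond_a (R : realType) (X : countType) (Lambda : set X)
    (c w : X -> R) (alpha : X -> X -> R) : Prop :=
  neumann_sum Lambda c w (emx_of alpha) < +oo.

Definition cond_b (R : realType) (X : countType) (Lambda : set X)
    (c w : X -> R) (alpha : X -> X -> R) : Prop :=
  forall h : X -> R, unit_valued h -> fsupp h = Lambda ->
    (exists2 eps : R, (0 < eps)%R & forall x, (eps * \1_Lambda x <= h x)%R) ->
    neumann_sum Lambda c w (cleaning alpha h) < +oo.

Definition cond_b' (R : realType) (X : countType) (Lambda : set X)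
    (c w : X -> R) (alpha : X -> X -> R) : Prop :=
  exists h : X -> R, [/\ unit_valued h, fsupp h = Lambda &
    neumann_sum Lambda c w (cleaning alpha h) < +oo].

Definition cond_c (R : realType) (X : countType) (Lambda : set X)
    (c w : X -> R) (alpha : X -> X -> R) : Prop :=
  forall (m : nat) (f : 'I_m -> X -> R),
    (forall i, unit_valued (f i)) -> (forall i, fsupp (f i) `<=` Lambda) ->
    (exists2 eps : R, (0 < eps)%R &
       forall x, (eps * \1_Lambda x <= \sum_(i < m) f i x)%R) ->
    neumann_sum Lambda c w (cleaning_prod alpha f) < +oo.

Definition cond_c' (R : realType) (X : countType) (Lambda : set X)
    (c w : X -> R) (alpha : X -> X -> R) : Prop :=
  exists (m : nat) (f : 'I_m -> X -> R),
    [/\ forall i, unit_valued (f i), forall i, fsupp (f i) `<=` Lambda &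
        neumann_sum Lambda c w (cleaning_prod alpha f) < +oo].

Definition cond_d (R : realType) (X : countType) (Lambda : set X)
    (c w : X -> R) (alpha : X -> X -> R) : Prop :=
  forall nu : cloud R X,
    cloud_ge0 nu -> carried_by Lambda nu -> cloud_norm nu <= 1 ->
    (exists2 eps : R, (0 < eps)%R &
       forall x, Lambda x -> (nu (x, [::]) <= 1 - eps)%R) ->
    neumann_sum Lambda c w (cloud_mx alpha nu) < +oo.

Definition cond_d' (R : realType) (X : countType) (Lambda : set X)
    (c w : X -> R) (alpha : X -> X -> R) : Prop :=
  exists nu : cloud R X,
    [/\ cloud_S1 nu, carried_by Lambda nu, finitely_many_levels nu &
        neumann_sum Lambda c w (cloud_mx alpha nu) < +oo].

(* Main.v *)
Require Import Defs.
From HB Require Import structures.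
From mathcomp Require Import all_boot all_order all_algebra.
From mathcomp Require Import all_classical all_reals all_analysis.
From mathcomp Require Import ring lra zify.
Import Order.TTheory GRing.Theory Num.Theory.
Local Open Scope classical_set_scope.
Local Open Scope ring_scope.

(** Every matrix in the theorem is of the form T_nu for some cloud nu >= 0, and
multiplying such matrices amounts to convolving clouds, i.e. to cutting a
marker in two at one of its points ([cloud_mx_conv]).  The restriction to
Lambda only replaces nu by its restriction to the markers with both ends in
Lambda.  Hence a Neumann sum is a sum over all markers (x_0, ..., x_k) of the
common weight c(x_0) alpha(x_0, x_1) ... alpha(x_{k-1}, x_k) w(x_k) times
mu(x_0, ..., x_k), where mu is the sum of all convolution powers of the
restricted cloud ([neumann_cloud], [nneseries_cloud_value]).  For alpha
itself, mu is the indicator function of the admissible markers, those of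
level 0 and those with all their points in Lambda
([nneseries_cpow_inner_step]).  The theorem thus reduces to comparing mu with
that indicator function, one marker at a time.

For this, read the values of nu along a path x_0, x_1, ... as jump
probabilities: from position l, jump to position l + j with probability
nu(x_l, ..., x_{l+j}).  This is an inhomogeneous renewal process, and
mu(x_0, ..., x_k) is the expected number of visits to position k.

Upper bound: if the jump probabilities sum to at most 1 and the probability of
staying in place is at most 1 - eps, the expected number of visits is at most
1 / eps ([partial_renewal_le]).  So condition (a) bounds every Neumann sum in
(d), and those of (b) and (c) are particular cases, since a product of
cleaning operators is T_nu for the convolution nu of the clouds of its factors.

Lower bound: if the jumps have total probability 1 and length at most N, and
the process never stays in place almost surely, it must visit each window of N
consecutive positions ([renewal_window_ge1]).  For a single cleaning operator
N = 1, so mu is at least 1 on admissible markers and (b') gives (a) directly.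
For a general cloud in (d') one only controls the sum of mu over the N last
ancestors of a marker; completing these ancestors by up to N - 1 steps of
I_Lambda alpha I_Lambda costs powers of the constant C
([cloud_value_inner_step]).  Staying in place almost surely at a point x of
Lambda would make the Neumann sum at least the divergent sum of the constants
c(x) w(x) ([cloud_at_point_lt1]). *)

(** * Sums in [0, +oo] *)

Section ExtendedSums.
Local Open Scope ereal_scope.
Context {R : realType}.

Lemma esum_ge_term {T : choiceType} (I : set T) (a : T -> \bar R) i :
  (forall j, 0 <= a j) -> I i -> a i <= \esum_(j in I) a j.
Proof.
move=> a0 Ii; apply: esum_ge; exists [set i]; last by rewrite fsbig_set1.
by split; [exact: finite_set1 | move=> _ ->].
Qed.

Lemma esum_only1 {T : choiceType} (I : set T) (a : T -> \bar R) i :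
  (forall j, 0 <= a j) -> (forall j, I j -> j != i -> a j = 0) -> I i ->
  \esum_(j in I) a j = a i.
Proof.
move=> a0 ai Ii; rewrite (esumID [set i])//.
rewrite [X in _ + X]esum1 ?adde0; last first.
  by move=> j [Ij /= /eqP ji]; exact: ai.
by rewrite (_ : _ `&` _ = [set i]) ?esum_set1//; apply/seteqP; split => [j []|j ->].
Qed.

(** An infinite factor occurs when a product of two sums is expanded: it is the
value of one of them. *)
Lemma esumZl {T : choiceType} (I : set T) (x : \bar R) (a : T -> \bar R) :
  0 <= x -> (forall i, 0 <= a i) ->
  \esum_(i in I) (x * a i) = x * \esum_(i in I) a i.
Proof.
(* For a finite nonzero factor the other inequality is this one for its inverse. *)
have half (y : \bar R) (b : T -> \bar R) : 0 <= y -> (forall i, 0 <= b i) ->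
    \esum_(i in I) (y * b i) <= y * \esum_(i in I) b i.
  move=> y0 b0; apply: ge_ereal_sup => _ [F [finF FI] <-].
  rewrite -ge0_mule_fsumr//; apply: lee_wpmul2l => //.
  by apply: esum_ge; exists F.
move=> x0 a0; apply/eqP; rewrite eq_le half//=.
have s0 : 0 <= \esum_(i in I) a i by exact: esum_ge0.
case: x x0 => [r| |] // r0.
  have [->|rn0] := eqVneq r 0%R; first by rewrite mul0e esum_ge0// => *; rewrite mul0e.
  have rp : (0 < r)%R by rewrite lt_neqAle eq_sym rn0 -lee_fin.
  rewrite -lee_pdivlMl// (_ : esum I a = \esum_(i in I) (r^-1%:E * (r%:E * a i))).
    by apply: half => [|i]; rewrite ?mule_ge0// lee_fin invr_ge0.
  by apply: eq_esum => i _; rewrite muleA -EFinM mulVf// mul1e.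
have [[i Ii ai]|az] := pselect (exists2 i, I i & 0 < a i).
  have : +oo * a i <= \esum_(i in I) (+oo * a i).
    by apply: (@esum_ge_term _ _ (fun i => +oo * a i)) => // j; rewrite mule_ge0.
  by rewrite gt0_mulye// => /(le_trans (leey _)).
rewrite (_ : esum I a = 0) ?mule0; first by apply: esum_ge0 => *; rewrite mule_ge0.
apply: esum1 => i Ii; apply/eqP; rewrite eq_le a0 andbT leNgt.
by apply/negP => ai; apply: az; exists i.
Qed.

Lemma esumZr {T : choiceType} (I : set T) (x : \bar R) (a : T -> \bar R) :
  0 <= x -> (forall i, 0 <= a i) ->
  \esum_(i in I) (a i * x) = (\esum_(i in I) a i) * x.
Proof.
by move=> x0 a0; rewrite muleC -esumZl//; apply: eq_esum => i _; rewrite muleC.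
Qed.

Lemma exchange_esum {T U : choiceType} (I : set T) (J : set U)
    (a : T -> U -> \bar R) : (forall i j, 0 <= a i j) ->
  \esum_(i in I) \esum_(j in J) a i j = \esum_(j in J) \esum_(i in I) a i j.
Proof.
move=> a0; rewrite !esum_esum//.
rewrite (reindex_esum (J `*`` fun=> I) _ (fun u => (u.2, u.1)))//.
split=> [[j i] []//|[j i] [j' i'] _ _ [-> ->]//|[i j] [/= Ii Jj]].
by exists (j, i).
Qed.

Lemma nneseries_exchange_esum {T : choiceType} (I : set T)
    (a : nat -> T -> \bar R) : (forall k i, 0 <= a k i) ->
  \sum_(k <oo) \esum_(i in I) a k i = \esum_(i in I) \sum_(k <oo) a k i.
Proof.
move=> a0; rewrite nneseries_esumT; last by move=> *; exact: esum_ge0.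
rewrite exchange_esum//; apply: eq_esum => i _.
by rewrite nneseries_esumT.
Qed.

End ExtendedSums.

(** * Matrices with entries in [0, +oo] *)

Section Matrices.
Local Open Scope ereal_scope.
Context {R : realType} {X : countType}.
Implicit Types (A B : emx R X) (f c w : X -> R).

Definition emx_ge0 A := forall x y, 0 <= A x y.

Lemma emx_diag_mul f A x y : (forall z, (0 <= f z)%R) -> emx_ge0 A ->
  emx_mul (emx_diag f) A x y = (f x)%:E * A x y.
Proof.
move=> f0 A0; rewrite /emx_mul (@esum_only1 _ _ _ _ x)//.
- by rewrite /emx_diag eqxx mulr1n.
- by move=> z; rewrite mule_ge0// lee_fin mulrn_wge0.
- by move=> z _ zx; rewrite /emx_diag eq_sym (negbTE zx) mulr0n mul0e.
Qed.

Lemma emx_mul_diag f A x y : (forall z, (0 <= f z)%R) -> emx_ge0 A ->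
  emx_mul A (emx_diag f) x y = A x y * (f y)%:E.
Proof.
move=> f0 A0; rewrite /emx_mul (@esum_only1 _ _ _ _ y)//.
- by rewrite /emx_diag eqxx mulr1n.
- by move=> z; rewrite mule_ge0// lee_fin mulrn_wge0.
- by move=> z _ zx; rewrite /emx_diag (negbTE zx) mulr0n mule0.
Qed.

Lemma emx_mul_ge0 A B : emx_ge0 A -> emx_ge0 B -> emx_ge0 (emx_mul A B).
Proof. by move=> A0 B0 x y; apply: esum_ge0 => z _; exact: mule_ge0. Qed.

Lemma emx_diag_ge0 f : (forall z, (0 <= f z)%R) -> emx_ge0 (emx_diag f).
Proof. by move=> f0 x y; rewrite lee_fin mulrn_wge0. Qed.

Lemma indic_ge0 (Lambda : set X) x : (0 <= \1_Lambda x :> R)%R.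
Proof. by rewrite indicE. Qed.

Lemma emx_restrictE (Lambda : set X) A x y : emx_ge0 A ->
  emx_restrict Lambda A x y = (\1_Lambda x)%:E * A x y * (\1_Lambda y)%:E.
Proof.
move=> A0; have i0 := indic_ge0 Lambda.
rewrite /emx_restrict emx_mul_diag ?emx_diag_mul//.
by apply: emx_mul_ge0 => //; exact: emx_diag_ge0.
Qed.

Lemma emx_col_mul A B w x : emx_ge0 A -> emx_ge0 B -> (forall z, (0 <= w z)%R) ->
  emx_col (emx_mul A B) w x = \esum_(z in [set: X]) (A x z * emx_col B w z).
Proof.
move=> A0 B0 w0; rewrite /emx_col /emx_mul.
under eq_esum => y _.
  rewrite -esumZr ?lee_fin//; last by move=> z; exact: mule_ge0.
over.
rewrite exchange_esum; last first.
  by move=> y z; rewrite ?mule_ge0 ?lee_fin.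
apply: eq_esum => z _; rewrite -esumZl//; last first.
  by move=> y; rewrite mule_ge0 ?lee_fin.
by apply: eq_esum => y _; rewrite muleA.
Qed.

(** Regrouping c (A B) w as c A (B w) is what lets the bound B w <= C w be
applied next to w, however large A is. *)
Lemma row_col_mul_le A B c w (C : R) : emx_ge0 A -> emx_ge0 B ->
  (forall x, (0 <= c x)%R) -> (forall x, (0 <= w x)%R) -> (0 <= C)%R ->
  (forall x, emx_col B w x <= (C * w x)%:E) ->
  row_col c (emx_col (emx_mul A B) w) <= C%:E * row_col c (emx_col A w).
Proof.
move=> A0 B0 c0 w0 C0 BC; rewrite /row_col -esumZl ?lee_fin//; last first.
  by move=> x; rewrite mule_ge0 ?lee_fin// esum_ge0// => y _; rewrite mule_ge0 ?lee_fin.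
apply: le_esum => x _; rewrite muleCA lee_wpmul2l ?lee_fin//.
rewrite emx_col_mul// /emx_col -esumZl ?lee_fin//; last first.
  by move=> y; rewrite mule_ge0 ?lee_fin.
by apply: le_esum => z _; rewrite [leRHS]muleCA -EFinM lee_wpmul2l//; exact: BC.
Qed.

End Matrices.

(** * Convolution of clouds *)

Section Convolution.
Context {R : realType} {X : countType}.
Implicit Types (a b : cloud R X) (f : X -> R) (eta : marker X).

Definition msuffix eta j : marker X := (mnth eta j, drop j eta.2).

(** The point at which the marker is cut belongs to both pieces, as the matrix
product requires. *)
Definition cconv a b : cloud R X := fun eta =>
  \sum_(0 <= j < (level eta).+1) a (mprefix eta j) * b (msuffix eta j).

Definition cshift x a : cloud R X := fun eta => a (x, eta.1 :: eta.2).

Definition cdiag f : cloud R X := fun eta => f eta.1 *+ (level eta == 0)%N.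

Definition cpow a k : cloud R X := iter k (cconv a) (cdiag (fun=> 1)).

Lemma cconv_nil a b x : cconv a b (x, [::]) = a (x, [::]) * b (x, [::]).
Proof. by rewrite /cconv big_nat1. Qed.

(** Isolating the cut at the first point makes convolution amenable to
induction on the marker. *)
Lemma cconv_cons a b x y s :
  cconv a b (x, y :: s) =
  a (x, [::]) * b (x, y :: s) + cconv (cshift x a) b (y, s).
Proof.
rewrite /cconv big_nat_recl//=; congr (_ + _).
rewrite !big_nat; apply: eq_bigr => j /andP[_ jn]; congr (_ * b _).
by rewrite /msuffix /mnth /=; congr (_, _); exact: set_nth_default.
Qed.

Lemma cconv_ge0 a b : cloud_ge0 a -> cloud_ge0 b -> cloud_ge0 (cconv a b).
Proof. by move=> a0 b0 eta; apply: sumr_ge0 => j _; exact: mulr_ge0. Qed.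

Lemma cdiag_ge0 f : (forall x, 0 <= f x) -> cloud_ge0 (cdiag f).
Proof. by move=> f0 eta; exact: mulrn_wge0. Qed.

Lemma cpow_ge0 a k : cloud_ge0 a -> cloud_ge0 (cpow a k).
Proof.
by move=> a0; elim: k => [|k IH]; [exact: cdiag_ge0|exact: cconv_ge0].
Qed.

Lemma cconv_linl (r : R) a a' b eta :
  cconv (fun s => r * a s + a' s) b eta = r * cconv a b eta + cconv a' b eta.
Proof.
rewrite /cconv mulr_sumr -big_split; apply: eq_bigr => j _ /=.
by rewrite mulrDl mulrA.
Qed.

Lemma cconv_sumr a n (b : 'I_n -> cloud R X) eta :
  cconv a (fun s => \sum_(k < n) b k s) eta = \sum_(k < n) cconv a (b k) eta.
Proof. by rewrite /cconv exchange_big; apply: eq_bigr => j _; rewrite mulr_sumr. Qed.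

(** Both sides sum over the ways of cutting a marker in three.  Besides the
associativity of matrix products, this covers ancestor sums, which are
convolutions with the constant 1 ([ancestor_sumE]), and the window sums of
[renewal_window_ge1]. *)
Lemma cconvA a b d : cconv (cconv a b) d = cconv a (cconv b d).
Proof.
apply/funext => -[x s]; elim: s x a => [|y s IH] x a.
  by rewrite !cconv_nil mulrA.
rewrite !cconv_cons cconv_nil.
rewrite (_ : cshift x (cconv a b) = fun e =>
    a (x, [::]) * cshift x b e + cconv (cshift x a) b e); last first.
  by apply/funext => e; rewrite /cshift cconv_cons -surjective_pairing.
by rewrite cconv_linl IH mulrDr mulrA addrA.
Qed.

Lemma cconv_diagl f b eta : cconv (cdiag f) b eta = f eta.1 * b eta.
Proof.
case: eta => x [|y s]; first by rewrite cconv_nil.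
rewrite cconv_cons /cdiag /= /cconv big1 ?addr0// => j _.
by rewrite /cshift mulr0n mul0r.
Qed.

Lemma cconv_diagr f a eta : cconv a (cdiag f) eta = a eta * f (last eta.1 eta.2).
Proof.
case: eta => x s; elim: s x a => [|y s IH] x a; first by rewrite cconv_nil.
by rewrite cconv_cons IH /cdiag /= mulr0n mulr0 add0r.
Qed.

Lemma cconv1r a : cconv a (cdiag (fun=> 1)) = a.
Proof. by apply/funext => eta; rewrite cconv_diagr mulr1. Qed.

Lemma cconv1l a : cconv (cdiag (fun=> 1)) a = a.
Proof. by apply/funext => eta; rewrite cconv_diagl mul1r. Qed.

Lemma ancestor_sumE a : ancestor_sum a = cconv a (fun=> 1).
Proof. by apply/funext => eta; apply: eq_bigr => j _; rewrite mulr1. Qed.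

Lemma level_msuffix eta j : level (msuffix eta j) = (level eta - j)%N.
Proof. by rewrite /level size_drop. Qed.

Lemma mnth_last eta j : (j <= level eta)%N ->
  mnth eta j = last eta.1 (mprefix eta j).2.
Proof.
case: eta => x s /=; rewrite /level /mnth /= => js.
elim: j s x js => [|j IH] [|y s] x //= js.
by rewrite -IH//; exact: set_nth_default.
Qed.

Lemma mprefix_level eta : mprefix eta (level eta) = eta.
Proof. by case: eta => x s; rewrite /mprefix /level take_size. Qed.

End Convolution.

(** * Renewal estimates along a marker *)

Section Renewal.
Context {R : realType} {X : countType} (Lambda : set X).
Implicit Types (a b : cloud R X) (eta : marker X).

Definition inside eta := all (fun z => z \in Lambda) (eta.1 :: eta.2).

(** The markers that occur in the Neumann sum of alpha: the zeroth power is the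
full identity matrix, so a marker of level 0 may lie outside Lambda. *)
Definition admissible eta := (level eta == 0)%N || inside eta.

Lemma inside_split eta j : (j <= level eta)%N ->
  inside eta = inside (mprefix eta j) && inside (msuffix eta j).
Proof.
move=> jn; rewrite /inside/= mnth_last//.
rewrite -[in LHS](cat_take_drop j eta.2) all_cat /=.
case E : (all _ (take j _)); rewrite ?andbF//= ?andbT.
case x0 : (_ \in _) => //=.
have : last eta.1 (take j eta.2) \in eta.1 :: take j eta.2 by exact: mem_last.
rewrite inE => /orP[/eqP ->|/(allP E) ->//].
by rewrite x0.
Qed.

Lemma admissible_split eta j : (j <= level eta)%N ->
  inside (mprefix eta j) -> admissible (msuffix eta j) -> inside eta.
Proof.
move=> jn ip; rewrite /admissible level_msuffix subn_eq0 => /orP[nj|].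
  by rewrite -(mprefix_level eta) (_ : level eta = j)//; apply/eqP; rewrite eqn_leq nj.
by rewrite (inside_split _ _ jn) ip.
Qed.

Lemma inside_admissible_suffix eta j :
  (j <= level eta)%N -> inside eta -> admissible (msuffix eta j).
Proof.
by move=> jn; rewrite (inside_split _ _ jn) => /andP[_ i]; rewrite /admissible i orbT.
Qed.

Definition partial_renewal a n : cloud R X := fun eta => \sum_(k < n) cpow a k eta.

Lemma partial_renewalS a n eta :
  partial_renewal a n.+1 eta = cdiag (fun=> 1) eta + cconv a (partial_renewal a n) eta.
Proof. by rewrite /partial_renewal big_ord_recl cconv_sumr. Qed.

(** The induction is on the number of powers.  By [partial_renewalS] (splitting
off the first jump) the bound 1 / eps is preserved at positive level because
the jump probabilities sum to at most 1; at level 0 there is the additional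
term 1, but the only jump stays in place, and 1 + (1 - eps) / eps = 1 / eps.
The support is preserved because a marker cut into a piece inside Lambda and
an admissible piece is itself inside Lambda. *)
Lemma partial_renewal_le a (eps : R) n eta :
  cloud_ge0 a -> (forall s, ~~ inside s -> a s = 0) ->
  (forall s, ancestor_sum a s <= 1) ->
  0 < eps <= 1 -> (forall x, a (x, [::]) <= 1 - eps) ->
  partial_renewal a n eta <= eps^-1 * (admissible eta)%:R.
Proof.
move=> a0 aL a1 /andP[e0 e1] ae; have M0 : 0 <= eps^-1 by rewrite invr_ge0 ltW.
elim: n eta => [|n IH] eta; first by rewrite /partial_renewal big_ord0 mulr_ge0.
rewrite partial_renewalS.
have step : cconv a (partial_renewal a n) eta <= eps^-1 * ancestor_sum a eta.
  rewrite /cconv /ancestor_sum mulr_sumr; apply: ler_sum => j _.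
  rewrite [leRHS]mulrC ler_wpM2l//; apply: (le_trans (IH _)).
  by rewrite ler_piMr//; case: (admissible _).
case: eta step => x [|y s] step.
  rewrite /admissible /cdiag /= mulr1n.
  move: step; rewrite /ancestor_sum big_nat1 => step.
  have := le_trans step (ler_wpM2l M0 (ae x)).
  by rewrite mulrBr mulVf ?gt_eqF// mulr1; lra.
rewrite /cdiag /= mulr0n add0r.
have [ok|ko] := boolP (admissible _).
  by rewrite mulr1; apply: (le_trans step); rewrite ler_piMr.
rewrite mulr0 /cconv big_nat big1// => j /andP[_ jn].
have [ip|/aL ->] := boolP (inside (mprefix (x, y :: s) j)); last by rewrite mul0r.
suff -> : partial_renewal a n (msuffix (x, y :: s) j) = 0 by rewrite mulr0.
apply/eqP; rewrite eq_le [_ <= partial_renewal _ _ _]sumr_ge0 ?andbT; last first.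
  by move=> k _; exact: cpow_ge0.
apply: (le_trans (IH _)); have [as_|] := boolP (admissible (msuffix _ _)).
  by move: ko; rewrite /admissible (admissible_split _ _ jn ip as_).
by rewrite mulr0.
Qed.

(** The series is the expected number of visits to the N last positions of the
marker: the cloud b equals 1 on the markers that join such a position to the
end.  Call it G.  When the marker is shorter than N the starting point is in
the window.  Otherwise decompose at the first jump: with p the probability of
staying in place, induction bounds the contribution of the other jumps by
1 - p, so G >= p G + (1 - p), and p < 1 gives G >= 1. *)
Lemma renewal_window_ge1 a b N eta : (0 < N)%N ->
  cloud_ge0 a -> cloud_ge0 b ->
  (forall s, inside s -> (N <= level s)%N -> ancestor_sum a s = 1) ->
  (forall x, Lambda x -> a (x, [::]) < 1) ->
  (forall s, admissible s -> (level s < N)%N -> b s = 1) ->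
  admissible eta ->
  (1 <= \sum_(k <oo) (cconv (cpow a k) b eta)%:E)%E.
Proof.
move=> N0 a0 b0 a1 ax b1.
pose v k := cconv (cpow a k) b.
have v0 k s : (0 <= (v k s)%:E)%E by rewrite lee_fin cconv_ge0//; exact: cpow_ge0.
pose G s := (\sum_(k <oo) (v k s)%:E)%E.
rewrite -/(G eta).
have [m] := ubnP (level eta); elim: m eta => // m IH eta etam ok.
have GE : G eta = ((v 0 eta)%:E + \sum_(0 <= j < (level eta).+1)
    ((a (mprefix eta j))%:E * G (msuffix eta j)))%E.
  rewrite /G nneseries_recl//; congr (_ + _)%E.
  rewrite -nneseries_addn//.
  under eq_bigr do rewrite -nneseriesZl//.
  rewrite -nneseries_sum; last by move=> j k _; rewrite mule_ge0// lee_fin.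
  apply: eq_eseriesr => k _; rewrite addn1 /v /= cconvA.
  by rewrite -sumEFin; apply: eq_bigr => j _; rewrite EFinM.
have [lN|Nl] := ltnP (level eta) N.
  rewrite GE /v /= cconv1l b1// leeDl// big_nat sume_ge0// => j _.
  by rewrite mule_ge0 ?lee_fin// nneseries_ge0.
have ine : inside eta.
  by move: ok; rewrite /admissible gtn_eqF// (leq_trans N0).
have := a1 _ ine Nl; rewrite /ancestor_sum big_nat_recl// => a1e.
have p0 : mprefix eta 0 = (eta.1, [::]) by rewrite /mprefix take0.
have s0 : msuffix eta 0 = eta by case: (eta) => x s; rewrite /msuffix drop0.
(* p is the value of a at the one-point marker of the first point of eta. *)
have key : ((a (eta.1, [::]))%:E * G eta + (1 - a (eta.1, [::]))%:E <= G eta)%E.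
  rewrite [leRHS]GE; apply: lee_paddl => //.
  rewrite big_nat_recl// p0 s0 leeD2l//.
  rewrite -a1e p0 addrC addKr -sumEFin !big_nat.
  apply: lee_sum => j /andP[_ jl]; rewrite -[leLHS]mule1 lee_wpmul2l ?lee_fin//.
  by apply: IH; [rewrite level_msuffix; lia|exact: inside_admissible_suffix].
have alt : a (eta.1, [::]) < 1.
  by apply: ax; move: ine => /andP[+ _]; rewrite inE.
have : (0 <= G eta)%E by rewrite nneseries_ge0.
case: (G eta) key => [r| |] //; last by move=> *; rewrite leey.
rewrite -EFinM -EFinD !lee_fin => key _.
have : 0 <= (1 - a (eta.1, [::])) * (r - 1) by nra.
by rewrite pmulr_rge0 ?subr_gt0// subr_ge0.
Qed.

End Renewal.

(** * Matrices of clouds *)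

Section CloudMatrices.
Context {R : realType} {X : countType} (alpha : X -> X -> R).
Context (alpha_ge0 : forall x y, 0 <= alpha x y).
Implicit Types (a b nu : cloud R X) (eta : marker X) (f c w : X -> R).

Lemma path_weight_nil x : path_weight alpha (x, [::]) = 1.
Proof. by rewrite /path_weight big_nil. Qed.

Lemma path_weight_cons x y s :
  path_weight alpha (x, y :: s) = alpha x y * path_weight alpha (y, s).
Proof.
rewrite /path_weight big_nat_recl//=; congr (_ * _).
rewrite !big_nat; apply: eq_bigr => j /andP[_ js].
by rewrite /mnth /=; congr alpha; apply: set_nth_default => //=; exact: ltnW.
Qed.

Lemma path_weight_ge0 eta : 0 <= path_weight alpha eta.
Proof. by apply: prodr_ge0. Qed.

Lemma path_weight_split eta j : (j <= level eta)%N ->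
  path_weight alpha eta =
  path_weight alpha (mprefix eta j) * path_weight alpha (msuffix eta j).
Proof.
case: eta => x s; rewrite /level /=.
elim: j x s => [|j IH] x s js.
  by rewrite /mprefix take0 path_weight_nil mul1r /msuffix drop0.
case: s js => [|y s] //= js.
rewrite path_weight_cons (IH y s js) mulrA -path_weight_cons.
congr (_ * path_weight _ _).
by rewrite /msuffix /mnth /=; congr (_, _); exact: set_nth_default.
Qed.

Lemma mnth0 eta : mnth eta 0 = eta.1. Proof. by []. Qed.

Lemma mnth_level eta : mnth eta (level eta) = last eta.1 eta.2.
Proof. by rewrite mnth_last// mprefix_level. Qed.

Definition between x y :=
  [set eta : marker X | mnth eta 0 = x /\ mnth eta (level eta) = y].

(** Gluing two markers at a common end inverts cutting one of them; the cut
point u.1.1 is the summation index of the matrix product. *)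
Lemma between_split_bij x y :
  set_bij (between x y `*`` (fun eta => `I_(level eta).+1))
    (([set: X] `*`` between x) `*`` (fun u => between u.1 y))
    (fun u => ((mnth u.1 u.2, mprefix u.1 u.2), msuffix u.1 u.2)).
Proof.
have lastE eta j : (j <= level eta)%N -> mnth eta (level eta) =
    mnth (msuffix eta j) (level (msuffix eta j)).
  move=> jn; rewrite !mnth_level/= mnth_last//.
  by rewrite -last_cat cat_take_drop.
split.
- move=> [eta j] /= [[e0 ey] jn]; rewrite ltnS in jn.
  split => //=; last by rewrite /between /= -lastE.
  split => //; split; first by rewrite mnth0.
  by rewrite mnth_level mnth_last.
- move=> [[x1 s1] j] [[x2 s2] k] /set_mem [/= _ j1] /set_mem [/= _ k2].
  rewrite ltnS in j1; rewrite ltnS in k2.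
  rewrite /mprefix /msuffix /= => -[_ -> t12 _ d12].
  have -> : s1 = s2 by rewrite -(cat_take_drop j s1) t12 d12 cat_take_drop.
  by move/(congr1 size): t12; rewrite !size_takel// => ->.
- move=> [[z [x1 s]] [z' t]] [[_ [/= e0 es]] [/= f0 ft]].
  rewrite mnth0 /= in e0; rewrite mnth0 /= in f0; rewrite mnth_level /= in es.
  rewrite mnth_level/= in ft; subst x1 z'.
  exists ((x, s ++ t), size s); last first.
    rewrite /mprefix /msuffix /= take_size_cat// drop_size_cat//.
    by rewrite mnth_last ?/level /= ?take_size_cat ?size_cat ?leq_addr// es.
  split; last by rewrite /= ltnS /level size_cat leq_addr.
  by split => //; rewrite mnth_level /= last_cat es.
Qed.

Lemma cloud_mx_ge0 nu : cloud_ge0 nu -> emx_ge0 (cloud_mx alpha nu).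
Proof.
move=> nu0 x y; apply: esum_ge0 => eta _.
by rewrite lee_fin mulr_ge0// path_weight_ge0.
Qed.

Lemma esum_ord n (g : nat -> \bar R) : (forall i, 0 <= g i)%E ->
  (\esum_(i in `I_n) g i = \sum_(0 <= i < n) g i)%E.
Proof.
move=> g0; rewrite esum_fset//.
by rewrite -fsbig_ord big_mkord.
Qed.

(** Path weights are multiplicative under cutting, so both sides are the same
sum over the pairs of [between_split_bij]. *)
Lemma cloud_mx_conv a b : cloud_ge0 a -> cloud_ge0 b ->
  emx_mul (cloud_mx alpha a) (cloud_mx alpha b) = cloud_mx alpha (cconv a b).
Proof.
move=> a0 b0; apply/funext => x; apply/funext => y; rewrite /emx_mul.
pose wt (d : cloud R X) eta := (d eta * path_weight alpha eta)%:E.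
have wt0 d : cloud_ge0 d -> forall eta, (0 <= wt d eta)%E.
  by move=> d0 eta; rewrite lee_fin mulr_ge0// path_weight_ge0.
transitivity (\esum_(z in [set: X]) \esum_(s in between x z)
    \esum_(t in between z y) (wt a s * wt b t))%E.
  apply: eq_esum => z _; rewrite -esumZr ?cloud_mx_ge0//; last exact: wt0.
  by apply: eq_esum => s _; rewrite -esumZl ?wt0//; exact: wt0.
rewrite esum_esum; last first.
  by move=> z s _ _; apply: esum_ge0 => t _; rewrite mule_ge0 ?wt0.
rewrite (@esum_esum _ _ _ _ (fun u => between u.1 y)
    (fun u t => wt a u.2 * wt b t)%E); last first.
  by move=> u t _ _; rewrite mule_ge0 ?wt0.
rewrite (reindex_esum _ _ _ _ (between_split_bij x y)) /=.
rewrite -(@esum_esum _ _ _ _ (fun eta => `I_(level eta).+1)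
    (fun eta j => wt a (mprefix eta j) * wt b (msuffix eta j))%E); last first.
  by move=> u t _ _; rewrite mule_ge0 ?wt0.
apply: eq_esum => eta _; rewrite esum_ord; last first.
  by move=> j; rewrite mule_ge0 ?wt0.
rewrite /cconv mulr_suml -sumEFin !big_nat; apply: eq_bigr => j /andP[_ jn].
by rewrite (path_weight_split _ _ jn) mulrACA EFinM.
Qed.

Lemma emx_diag_cloud f : (forall x, 0 <= f x) ->
  emx_diag f = cloud_mx alpha (cdiag f).
Proof.
move=> f0; apply/funext => x; apply/funext => y; rewrite /emx_diag /cloud_mx.
have p0 eta : (0 <= (cdiag f eta * path_weight alpha eta)%:E)%E.
  by rewrite lee_fin mulr_ge0 ?cdiag_ge0// path_weight_ge0.
have [<-|xy] := eqVneq x y.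
  rewrite (@esum_only1 _ _ _ _ (x, [::]))//.
    by rewrite path_weight_nil mulr1.
  move=> [z [|u s]] [/=]; rewrite mnth0 /= => -> _; first by rewrite eqxx.
  by rewrite /cdiag /= mulr0n mul0r.
rewrite esum1// => -[z [|u s]] [/=]; rewrite mnth0 /=.
  by move=> -> /= xy'; move: xy; rewrite -xy' eqxx.
by rewrite /cdiag /= mulr0n mul0r.
Qed.

Lemma emx_one_cloud : @emx_one R X = cloud_mx alpha (cdiag (fun=> 1)).
Proof.
by rewrite -emx_diag_cloud.
Qed.

(** The cloud of alpha itself. *)
Definition cstep : cloud R X := fun eta => (level eta == 1)%:R.

Lemma cstep_ge0 : cloud_ge0 cstep. Proof. by move=> eta; exact: ler0n. Qed.

Lemma emx_of_cloud : emx_of alpha = cloud_mx alpha cstep.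
Proof.
apply/funext => x; apply/funext => y; rewrite /emx_of /cloud_mx.
rewrite (@esum_only1 _ _ _ _ (x, [:: y]))//.
- by rewrite path_weight_cons path_weight_nil mulr1 mul1r.
- by move=> eta; rewrite lee_fin mulr_ge0 ?cstep_ge0// path_weight_ge0.
- move=> [z [|u [|v s]]] [/=]; rewrite /mnth /cstep /= => -> uy.
  + by rewrite mul0r.
  + by rewrite uy eqxx.
  + by rewrite mul0r.
Qed.

End CloudMatrices.

(** * Neumann sums as sums over markers *)

Section NeumannSums.
Context {R : realType} {X : countType} (Lambda : set X).
Context (c w : X -> R) (alpha : X -> X -> R).
Context (c_ge0 : forall x, 0 <= c x).
Context (w_ge0 : forall x, 0 <= w x).
Context (alpha_ge0 : forall x y, 0 <= alpha x y).
Implicit Types (a b nu : cloud R X) (eta : marker X).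

Definition cloud_value nu : \bar R := row_col c (emx_col (cloud_mx alpha nu) w).

Definition marker_weight eta : \bar R :=
  (c eta.1 * path_weight alpha eta * w (last eta.1 eta.2))%:E.

Lemma marker_weight_ge0 eta : (0 <= marker_weight eta)%E.
Proof. by rewrite lee_fin !mulr_ge0// path_weight_ge0. Qed.

Lemma cloud_valueE nu : cloud_ge0 nu ->
  cloud_value nu = (\esum_(eta in [set: marker X])
                      ((nu eta)%:E * marker_weight eta))%E.
Proof.
move=> nu0; have A0 eta : (0 <= (nu eta * path_weight alpha eta)%:E)%E.
  by rewrite lee_fin mulr_ge0// path_weight_ge0.
pose g (x y : X) eta := ((c x)%:E *
  ((nu eta * path_weight alpha eta)%:E * (w y)%:E))%E.
have g0 x y eta : (0 <= g x y eta)%E by rewrite !mule_ge0// lee_fin.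
transitivity (\esum_(x in [set: X]) \esum_(y in [set: X])
    \esum_(eta in between x y) g x y eta)%E.
  apply: eq_esum => x _; rewrite /emx_col -esumZl ?lee_fin//; last first.
    by move=> y; rewrite mule_ge0 ?lee_fin//; exact: cloud_mx_ge0.
  apply: eq_esum => y _; rewrite /cloud_mx -esumZr ?lee_fin//.
  by rewrite -esumZl ?lee_fin// => eta; rewrite mule_ge0 ?A0 ?lee_fin.
under eq_esum => x _ do rewrite esum_esum//.
rewrite (@esum_esum _ _ _ _ (fun x => [set: X] `*`` between x)
  (fun x u => g x u.1 u.2))//.
rewrite (reindex_esum [set: marker X] _ (fun eta => (eta.1, (last eta.1 eta.2, eta)))).
  by apply: eq_esum => eta _; rewrite /g /marker_weight -!EFinM; congr (_%:E); ring.
split.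
- by move=> eta _ /=; split => //; split => //; rewrite /between/= mnth0 mnth_level.
- by move=> e1 e2 _ _ [].
- move=> [x [y eta]] [_ [_ []]] /=; rewrite mnth0 mnth_level => <- <-.
  by exists eta.
Qed.

Lemma cloud_value_ge0 nu : cloud_ge0 nu -> (0 <= cloud_value nu)%E.
Proof.
move=> nu0; rewrite cloud_valueE//; apply: esum_ge0 => eta _.
by rewrite mule_ge0 ?marker_weight_ge0 ?lee_fin//.
Qed.

Lemma cloud_value_ge_marker nu eta : cloud_ge0 nu ->
  ((nu eta)%:E * marker_weight eta <= cloud_value nu)%E.
Proof.
move=> nu0; rewrite cloud_valueE//.
apply: (@esum_ge_term _ _ _ (fun e => (nu e)%:E * marker_weight e)%E) => // e.
by rewrite mule_ge0 ?marker_weight_ge0 ?lee_fin//.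
Qed.

Lemma cloud_value_sum n (nu : 'I_n -> cloud R X) : (forall j, cloud_ge0 (nu j)) ->
  cloud_value (fun eta => \sum_(j < n) nu j eta) = (\sum_(j < n) cloud_value (nu j))%E.
Proof.
move=> nu0; rewrite cloud_valueE; last by move=> eta; apply: sumr_ge0 => j _; exact: nu0.
under [RHS]eq_bigr do rewrite cloud_valueE//.
rewrite -esum_sum; last first.
  move=> e j _ _; apply: mule_ge0; last exact: marker_weight_ge0.
  by rewrite lee_fin; exact: nu0.
apply: eq_esum => eta _; rewrite -sumEFin ge0_sume_distrl// => j _.
by rewrite lee_fin; exact: nu0.
Qed.

Lemma nneseries_cloud_value (nu : nat -> cloud R X) : (forall k, cloud_ge0 (nu k)) ->
  (\sum_(k <oo) cloud_value (nu k) = \esum_(eta in [set: marker X])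
     ((\sum_(k <oo) (nu k eta)%:E) * marker_weight eta))%E.
Proof.
move=> nu0.
under eq_eseriesr do rewrite cloud_valueE//.
rewrite nneseries_exchange_esum; last first.
  by move=> k e; apply: mule_ge0; [rewrite lee_fin; exact: nu0|exact: marker_weight_ge0].
apply: eq_esum => eta _; rewrite [RHS]muleC /marker_weight -nneseriesZl//.
  by apply: eq_eseriesr => k _; rewrite muleC.
by move=> k _; rewrite lee_fin; exact: nu0.
Qed.

(** This is how estimates on single markers yield estimates on Neumann sums:
the weight of a marker does not depend on the cloud. *)
Lemma le_nneseries_cloud_value (M : R) (nu nu' : nat -> cloud R X) : 0 <= M ->
  (forall k, cloud_ge0 (nu k)) -> (forall k, cloud_ge0 (nu' k)) ->
  (forall eta, \sum_(k <oo) (nu k eta)%:E <= M%:E * \sum_(k <oo) (nu' k eta)%:E)%E ->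
  (\sum_(k <oo) cloud_value (nu k) <= M%:E * \sum_(k <oo) cloud_value (nu' k))%E.
Proof.
move=> M0 nu0 nu'0 le; rewrite !nneseries_cloud_value// -esumZl ?lee_fin//.
  apply: le_esum => eta _; rewrite muleA lee_wpmul2r ?marker_weight_ge0//.
move=> eta; rewrite mule_ge0 ?marker_weight_ge0// nneseries_ge0// => k _ _.
by rewrite lee_fin; exact: nu'0.
Qed.

Definition crestr nu : cloud R X := fun eta =>
  \1_Lambda eta.1 * nu eta * \1_Lambda (last eta.1 eta.2).

Lemma crestr_ge0 nu : cloud_ge0 nu -> cloud_ge0 (crestr nu).
Proof. by move=> nu0 eta; rewrite !mulr_ge0// indic_ge0. Qed.

Lemma indic_le1 x : \1_Lambda x <= 1 :> R.
Proof. by rewrite indicE; case: (_ \in _). Qed.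

Lemma crestr_le nu eta : cloud_ge0 nu -> crestr nu eta <= nu eta.
Proof.
move=> nu0; rewrite /crestr -[leRHS]mulr1 ler_pM ?mulr_ge0 ?indic_ge0 ?indic_le1//.
by rewrite -[leRHS]mul1r ler_pM ?indic_ge0 ?indic_le1.
Qed.

Lemma crestr_inside nu eta : inside Lambda eta -> crestr nu eta = nu eta.
Proof.
move=> /allP ine; rewrite /crestr !indicE !ine ?mem_last ?mem_head//.
by rewrite mulr1 mul1r.
Qed.

(** Being carried by Lambda controls all the points of a marker but the last,
which the restriction takes care of. *)
Lemma crestr_outside nu eta : carried_by Lambda nu ->
  ~~ inside Lambda eta -> crestr nu eta = 0.
Proof.
move=> nuL /allPn[z zin zL]; rewrite /crestr !indicE.
have [lL|lL] := boolP (last eta.1 eta.2 \in Lambda); last by rewrite mulr0.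
rewrite nuL ?mulr0 ?mul0r//; exists (index z (eta.1 :: eta.2)); last first.
  by rewrite /mnth nth_index//; move: zL; rewrite notin_setE.
have := zin; rewrite -index_mem /= ltnS leq_eqVlt => /orP[/eqP iz|//].
by move: lL; rewrite -mnth_level /mnth /level -iz nth_index// (negbTE zL).
Qed.

Lemma emx_restrict_cloud nu : cloud_ge0 nu ->
  emx_restrict Lambda (cloud_mx alpha nu) = cloud_mx alpha (crestr nu).
Proof.
move=> nu0; apply/funext => x; apply/funext => y.
have A0 eta : (0 <= (nu eta * path_weight alpha eta)%:E)%E.
  by rewrite lee_fin mulr_ge0// path_weight_ge0.
rewrite emx_restrictE; last exact: cloud_mx_ge0.
rewrite /cloud_mx -esumZl ?lee_fin ?indic_ge0// -esumZr ?lee_fin ?indic_ge0//; last first.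
  by move=> eta; rewrite mule_ge0// lee_fin indic_ge0.
apply: eq_esum => eta [<- <-]; rewrite mnth0 mnth_level /crestr -!EFinM.
by congr (_%:E); ring.
Qed.

Lemma emx_pow_cloud nu k : cloud_ge0 nu ->
  emx_pow (cloud_mx alpha nu) k = cloud_mx alpha (cpow nu k).
Proof.
move=> nu0; elim: k => [|k IH]; first exact: emx_one_cloud.
by rewrite /emx_pow /= -/(emx_pow _ _) IH cloud_mx_conv//; exact: cpow_ge0.
Qed.

Lemma neumann_cloud nu : cloud_ge0 nu ->
  neumann_sum Lambda c w (cloud_mx alpha nu) =
  (\sum_(k <oo) cloud_value (cpow (crestr nu) k))%E.
Proof.
move=> nu0; apply: eq_eseriesr => k _.
by rewrite emx_restrict_cloud// emx_pow_cloud//; exact: crestr_ge0.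
Qed.

(** The cloud of I_Lambda alpha I_Lambda. *)
Definition inner_step := crestr (@cstep R X).

Lemma inner_step_ge0 : cloud_ge0 inner_step.
Proof. exact/crestr_ge0/cstep_ge0. Qed.

(** Each power fixes the level, so the sum over k counts every admissible
marker once. *)
Lemma cpow_inner_step k eta : cpow inner_step k eta =
  (level eta == k)%:R * (admissible Lambda eta)%:R.
Proof.
elim: k eta => [|k IH] [x s].
  by rewrite /= /cdiag /admissible; case: (level _) => [|n]; rewrite /= ?mulr1 ?mul0r.
case: s => [|y s]; rewrite [cpow _ _]/= -/(cpow _ _).
  by rewrite cconv_nil /inner_step /crestr /cstep /= mulr0 !mul0r.
rewrite cconv_cons {1}/inner_step {1}/crestr {1}/cstep /= mulr0 !mul0r add0r.
rewrite (_ : cshift x inner_step = cdiag (fun u => \1_Lambda x * \1_Lambda u)); last first.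
  apply/funext => -[u [|v t]]; rewrite /cshift /inner_step /crestr /cstep /cdiag /=.
    by rewrite mulr1.
  by rewrite mulr0 mul0r.
rewrite cconv_diagl IH /= /admissible /level /= eqSS /inside /= !indicE.
case: (x \in _); case: (y \in _); case: (_ == k); case: s => [|v s] //=;
  by rewrite ?(mul0r, mul1r, mulr0).
Qed.

Lemma nneseries_cpow_inner_step eta :
  (\sum_(k <oo) (cpow inner_step k eta)%:E = ((admissible Lambda eta)%:R)%:E)%E.
Proof.
have p0 k : (0 <= (cpow inner_step k eta)%:E)%E.
  by rewrite lee_fin; exact/cpow_ge0/inner_step_ge0.
rewrite nneseries_esumT// (@esum_only1 _ _ _ _ (level eta))//.
  by rewrite cpow_inner_step eqxx mul1r.
by move=> k _ kl; rewrite cpow_inner_step eq_sym (negbTE kl) mul0r.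
Qed.

Lemma neumann_alpha : neumann_sum Lambda c w (emx_of alpha) =
  (\sum_(k <oo) cloud_value (cpow inner_step k))%E.
Proof. by rewrite emx_of_cloud// neumann_cloud//; exact: cstep_ge0. Qed.

(** The constant in front is 1 / eps, from [partial_renewal_le]. *)
Lemma neumann_cloud_fin nu (eps : R) : cloud_ge0 nu -> carried_by Lambda nu ->
  (forall eta, ancestor_sum nu eta <= 1) -> 0 < eps <= 1 ->
  (forall x, Lambda x -> nu (x, [::]) <= 1 - eps) ->
  (neumann_sum Lambda c w (emx_of alpha) < +oo)%E ->
  (neumann_sum Lambda c w (cloud_mx alpha nu) < +oo)%E.
Proof.
move=> nu0 nuL nu1 /andP[e0 e1] nue; rewrite neumann_alpha (neumann_cloud _ nu0) => fin.
have M0 : 0 <= eps^-1 by rewrite invr_ge0 ltW.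
have r0 := crestr_ge0 _ nu0; have p0 k := cpow_ge0 _ k r0.
have s0 k := cpow_ge0 _ k inner_step_ge0.
apply: (@le_lt_trans _ _ (eps^-1%:E * \sum_(k <oo) cloud_value (cpow inner_step k))%E).
  apply: le_nneseries_cloud_value => // eta; rewrite nneseries_cpow_inner_step -EFinM.
  apply: lime_le; first by apply: is_cvg_nneseries => k _ _; rewrite lee_fin; exact: p0.
  apply: nearW => n; rewrite sumEFin lee_fin big_mkord.
  apply: partial_renewal_le => //; first by move=> s; exact: crestr_outside.
  - move=> s; apply: le_trans (nu1 s); apply: ler_sum => j _; exact: crestr_le.
  - by rewrite e0.
  - move=> x; have [xL|xL] := pselect (Lambda x).
      by apply: (le_trans (crestr_le _ _ nu0)); exact: nue.
    by rewrite /crestr indicE memNset// mulr0 subr_ge0.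
by rewrite lte_mul_pinfty ?lee_fin.
Qed.

(** By [renewal_window_ge1] every admissible marker is covered by a marker
visited by the renewal process, followed by j < N steps inside Lambda.  The
constants D j are the price of these j steps; for N = 1 there are none. *)
Lemma alpha_neumann_fin nu N (D : nat -> R) : cloud_ge0 nu -> carried_by Lambda nu ->
  (0 < N)%N ->
  (forall eta, (N <= level eta)%N -> ancestor_sum nu eta = 1) ->
  (forall x, Lambda x -> nu (x, [::]) < 1) ->
  (forall j, 0 <= D j) ->
  (forall j b, (j < N)%N -> cloud_ge0 b ->
     cloud_value (cconv b (cpow inner_step j)) <= (D j)%:E * cloud_value b)%E ->
  (neumann_sum Lambda c w (cloud_mx alpha nu) < +oo)%E ->
  (neumann_sum Lambda c w (emx_of alpha) < +oo)%E.
Proof.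
move=> nu0 nuL N0 nu1 nux D0 Dval; rewrite neumann_alpha (neumann_cloud _ nu0) => fin.
have r0 := crestr_ge0 _ nu0; have p0 k := cpow_ge0 _ k r0.
have s0 k := cpow_ge0 _ k inner_step_ge0.
(* The window cloud: 1 on the admissible markers of level less than N. *)
pose b eta := \sum_(j < N) cpow inner_step j eta.
have b0 : cloud_ge0 b by move=> eta; apply: sumr_ge0 => j _; exact: s0.
have pb0 k : cloud_ge0 (cconv (cpow (crestr nu) k) b) by exact: cconv_ge0.
apply: (@le_lt_trans _ _
  (1%:E * \sum_(k <oo) cloud_value (cconv (cpow (crestr nu) k) b))%E).
  apply: le_nneseries_cloud_value => // eta.
  rewrite nneseries_cpow_inner_step mul1e.
  have [ok|_] := boolP (admissible _ _); last first.
    by rewrite nneseries_ge0// => k _ _; rewrite lee_fin; exact: pb0.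
  apply: (@renewal_window_ge1 _ _ Lambda _ _ N) => //.
  - move=> s ins Ns; rewrite -(nu1 s Ns) /ancestor_sum !big_nat.
    apply: eq_bigr => j /andP[_ jl]; apply: crestr_inside.
    by move: ins; rewrite (inside_split _ _ j)// => /andP[].
  - move=> x Lx; rewrite crestr_inside; first exact: nux.
    by rewrite /inside /= andbT inE.
  - move=> s oks sN; rewrite /b (bigD1 (Ordinal sN))//= big1 ?addr0.
      by rewrite cpow_inner_step eqxx oks mulr1.
    move=> j jN; rewrite cpow_inner_step (_ : _ == _ = false) ?mul0r//.
    by apply/negbTE; apply: contraNneq jN => e; apply/eqP/val_inj.
rewrite mul1e.
apply: (@le_lt_trans _ _ ((\sum_(j < N) D j)%:E *
  \sum_(k <oo) cloud_value (cpow (crestr nu) k))%E); last first.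
  by rewrite lte_mul_pinfty ?lee_fin ?sumr_ge0.
rewrite -nneseriesZl; last by move=> k _; exact: cloud_value_ge0.
apply: lee_nneseries => k _; first by move=> _; exact: cloud_value_ge0.
rewrite (_ : cconv _ b = fun eta => \sum_(j < N)
    cconv (cpow (crestr nu) k) (cpow inner_step j) eta); last first.
  by apply/funext => eta; rewrite cconv_sumr.
rewrite cloud_value_sum; last by move=> j; exact: cconv_ge0.
rewrite -sumEFin ge0_sume_distrl; last by move=> j _; rewrite lee_fin.
by apply: lee_sum => j _; exact: Dval.
Qed.

(** Each step uses I_Lambda alpha I_Lambda w <= C w once, at the end of the
marker. *)
Lemma cloud_value_inner_step (C : R) b j : 0 <= C ->
  (forall x, (emx_col (emx_restrict Lambda (emx_of alpha)) w x <= (C * w x)%:E)%E) ->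
  cloud_ge0 b ->
  (cloud_value (cconv b (cpow inner_step j)) <= (C ^+ j)%:E * cloud_value b)%E.
Proof.
move=> C0 Cw; elim: j b => [|j IH] b b0.
  by rewrite /= cconv1r mul1e.
rewrite [cpow _ _]/= -/(cpow _ _) -cconvA.
apply: (le_trans (IH _ (cconv_ge0 _ _ b0 inner_step_ge0))).
rewrite exprSr EFinM -muleA lee_wpmul2l ?lee_fin ?exprn_ge0//.
rewrite /cloud_value -cloud_mx_conv//; last exact: inner_step_ge0.
apply: row_col_mul_le => //.
- exact: cloud_mx_ge0.
- exact/cloud_mx_ge0/inner_step_ge0.
- by move=> x; have := Cw x; rewrite emx_of_cloud// emx_restrict_cloud//; exact: cstep_ge0.
Qed.

(** Otherwise all the convolution powers are at least 1 at the one-point marker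
x, and each of them contributes at least c(x) w(x). *)
Lemma cloud_at_point_lt1 nu x : cloud_ge0 nu -> Lambda x -> 0 < c x -> 0 < w x ->
  (neumann_sum Lambda c w (cloud_mx alpha nu) < +oo)%E -> nu (x, [::]) < 1.
Proof.
move=> nu0 Lx cx wx; rewrite neumann_cloud// => fin.
rewrite ltNge; apply/negP => nux.
have r0 := crestr_ge0 _ nu0; have p0 k := cpow_ge0 _ k r0.
have px k : 1 <= cpow (crestr nu) k (x, [::]).
  elim: k => [|k IH]; first by rewrite /= /cdiag /= mulr1n.
  rewrite /= cconv_nil -[leLHS]mulr1 ler_pM// crestr_inside//.
  by rewrite /inside /= andbT inE.
have cw0 : 0 < c x * w x by exact: mulr_gt0.
have bound n : ((n%:R * (c x * w x))%:E <=
    \sum_(k <oo) cloud_value (cpow (crestr nu) k))%E.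
  apply: le_trans (nneseries_lim_ge n _); last by move=> k _ _; exact: cloud_value_ge0.
  rewrite (_ : (_ * _)%:E = \sum_(0 <= k < n) (c x * w x)%:E)%E; last first.
    by rewrite sumEFin sumr_const_nat subn0 mulr_natl.
  apply: lee_sum => k _; apply: le_trans (cloud_value_ge_marker _ (x, [::]) (p0 k)).
  rewrite /marker_weight /= path_weight_nil mulr1 -EFinM lee_fin.
  by rewrite ler_peMl// ltW.
have : (0 <= \sum_(k <oo) cloud_value (cpow (crestr nu) k))%E.
  by apply: nneseries_ge0 => k _ _; exact: cloud_value_ge0.
move: fin bound; case: (X in (X < _)%E) => [r| |] // _ bound r0'.
have := bound (Num.truncn (r / (c x * w x))).+1.
rewrite lee_fin -ler_pdivlMr// leNgt truncnS_gt//.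
Qed.

End NeumannSums.

(** * Stopping clouds and cleaning operators *)

Section StoppingClouds.
Context {R : realType} {X : countType}.
Implicit Types (a b nu : cloud R X) (eta : marker X) (f : X -> R) (Lambda : set X).

(** The clouds of S_1 supported on the levels up to N ([stopping_S1],
[S1_stopping]), in a form free of suprema.  They are the stopping rules that
end every path after at most N steps. *)
Definition stopping N nu := [/\ cloud_ge0 nu,
  forall eta, (N < level eta)%N -> nu eta = 0 &
  forall eta, (N <= level eta)%N -> ancestor_sum nu eta = 1].

Lemma level_mprefix eta j : (j <= level eta)%N -> level (mprefix eta j) = j.
Proof. exact: size_takel. Qed.

Lemma mprefix_cat (x : X) s t j : (j <= size s)%N ->
  mprefix (x, s ++ t) j = mprefix (x, s) j.
Proof. by move=> js; rewrite /mprefix /= takel_cat. Qed.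

Lemma ancestor_sum_cat nu x s t :
  ancestor_sum nu (x, s ++ t) = ancestor_sum nu (x, s) +
  \sum_((size s).+1 <= j < (size (s ++ t)).+1) nu (mprefix (x, s ++ t) j).
Proof.
rewrite /ancestor_sum /level /= (@big_cat_nat _ _ _ (size s).+1)//=; last first.
  by rewrite ltnS size_cat leq_addr.
congr (_ + _); rewrite !big_nat; apply: eq_bigr => j /andP[_ js].
by rewrite mprefix_cat.
Qed.

Lemma stopping_le1 N nu eta : stopping N nu -> ancestor_sum nu eta <= 1.
Proof.
case: eta => x s [nu0 _ nu1].
rewrite -(nu1 (x, s ++ nseq N x)); last by rewrite /level /= size_cat size_nseq leq_addl.
by rewrite ancestor_sum_cat lerDl sumr_ge0.
Qed.

Lemma stopping_widen N M nu : (N <= M)%N -> stopping N nu -> stopping M nu.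
Proof.
move=> NM [nu0 nuN nu1]; split => // eta Me.
  by apply: nuN; exact: leq_ltn_trans Me.
by apply: nu1; exact: leq_trans Me.
Qed.

(** Repeating the first point at the end extends any marker to a level at least
N, where the ancestor sum is 1. *)
Lemma stopping_S1 N nu : stopping N nu -> cloud_S1 nu.
Proof.
move=> nuN; have [nu0 _ nu1] := nuN; split => // -[x s].
apply/eqP; rewrite eq_le; apply/andP; split.
  by apply: ge_ereal_sup => _ [eta' _ <-]; rewrite lee_fin; exact: stopping_le1 nuN.
apply: ereal_sup_ubound; exists (x, s ++ nseq N x).
  exists (size s); first by rewrite /level /= size_cat leq_addr.
  by rewrite mprefix_cat// /mprefix take_size.
by rewrite nu1// /level /= size_cat size_nseq leq_addl.
Qed.

(** Beyond level N the ancestor sums no longer change, so the supremum over the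
descendants is the value at the marker itself. *)
Lemma S1_stopping N nu : cloud_S1 nu ->
  (forall eta, (N < level eta)%N -> nu eta = 0) -> stopping N nu.
Proof.
move=> [nu0 nu1] nuN; split => // -[x s] Ns; apply: EFin_inj.
rewrite -(nu1 (x, s)) -[LHS]ereal_sup1; congr (ereal_sup _).
apply/seteqP; split => [_ ->|_ [[y t] [j jt [-> st]] <-]].
  by exists (x, s) => //; exists (size s) => //; rewrite /mprefix take_size.
rewrite /= -(cat_take_drop j t) -st ancestor_sum_cat big_nat big1 ?addr0// => i /andP[si it].
apply: nuN; rewrite level_mprefix//; exact: leq_ltn_trans si.
Qed.

Lemma stopping_one : stopping 0 (cdiag (fun=> 1) : cloud R X).
Proof.
split=> [|eta|eta _]; first exact: cdiag_ge0.
  by rewrite /cdiag; case: (level eta).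
by rewrite ancestor_sumE cconv1l.
Qed.

(** Run the first rule, then the second one from where the first stopped. *)
Lemma stopping_conv N M a b :
  stopping N a -> stopping M b -> stopping (N + M) (cconv a b).
Proof.
move=> [a0 aN a1] [b0 bM b1]; split; first exact: cconv_ge0.
  move=> eta NMe; rewrite /cconv big_nat big1// => j /andP[_ je].
  have [Nj|jN] := ltnP N j; first by rewrite aN ?mul0r// level_mprefix.
  by rewrite bM ?mulr0// level_msuffix; lia.
move=> eta NMe; rewrite ancestor_sumE cconvA -ancestor_sumE.
rewrite -(a1 eta); last exact: leq_trans (leq_addr _ _) NMe.
rewrite /cconv /ancestor_sum !big_nat; apply: eq_bigr => j /andP[_ je].
have [Nj|jN] := ltnP N j; first by rewrite aN ?mul0r// level_mprefix.
by rewrite [X in _ * X]b1 ?mulr1// level_msuffix; lia.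
Qed.

Lemma carried_conv Lambda a b : carried_by Lambda a -> carried_by Lambda b ->
  carried_by Lambda (cconv a b).
Proof.
move=> aL bL [x s] [j js xj]; rewrite /cconv big_nat big1// => i /andP[_ ie].
rewrite ltnS in ie; have [ji|ij] := ltnP j i.
  rewrite aL ?mul0r//; exists j; first by rewrite level_mprefix.
  move: xj; rewrite /mnth /mprefix /= -[x :: take i s]/(take i.+1 (x :: s)).
  by rewrite nth_take ?ltnS// ltnW.
rewrite bL ?mulr0//; exists (j - i)%N.
  by rewrite level_msuffix ltn_sub2r//; exact: leq_ltn_trans js.
move: xj; rewrite /mnth /msuffix /= -[mnth (x, s) i]/(nth x (x :: s) i).
rewrite (_ : nth x (x :: s) i :: drop i s = drop i (x :: s)); last first.
  by rewrite [RHS](drop_nth x).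
by rewrite nth_drop subnKC// (set_nth_default x)//= ltnS ltnW.
Qed.

(** Stop at x with probability 1 - f x, else after one step. *)
Definition cleaning_cloud f : cloud R X := fun eta =>
  cdiag (fun x => 1 - f x) eta + cconv (cdiag f) (@cstep R X) eta.

Lemma cleaning_cloud0 f x : cleaning_cloud f (x, [::]) = 1 - f x.
Proof. by rewrite /cleaning_cloud cconv_diagl /cdiag /cstep /= mulr0 addr0. Qed.

Lemma cleaning_cloud_stopping f : unit_valued f -> stopping 1 (cleaning_cloud f).
Proof.
move=> f01; split.
- move=> eta; apply: addr_ge0; first last.
    by apply: cconv_ge0; [apply: cdiag_ge0 => x; case/andP: (f01 x)|exact: cstep_ge0].
  by apply: cdiag_ge0 => x; rewrite subr_ge0; case/andP: (f01 x).
- move=> eta l1; rewrite /cleaning_cloud cconv_diagl /cstep /cdiag.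
  by case: (level eta) l1 => [|[|n]] //=; rewrite mulr0 addr0.
- move=> [x [|y s]] // _; rewrite ancestor_sumE.
  rewrite (_ : cleaning_cloud f = fun eta =>
      1 * cdiag (fun x => 1 - f x) eta + cconv (cdiag f) (@cstep R X) eta); last first.
    by apply/funext => eta; rewrite mul1r.
  rewrite cconv_linl cconvA !cconv_diagl mul1r mulr1 cconv_cons /= {1}/cstep /= mul0r add0r.
  by rewrite (_ : cshift x _ = cdiag (fun=> 1)) ?cconv1l ?mulr1 ?subrK.
Qed.

Lemma cleaning_cloud_carried Lambda f : fsupp f `<=` Lambda ->
  carried_by Lambda (cleaning_cloud f).
Proof.
move=> fL [x s] [j js xj]; rewrite /cleaning_cloud cconv_diagl /cdiag /cstep.
case: s js xj => [|y [|z s]] //= js xj; last by rewrite mulr0 addr0.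
move: js xj; rewrite /level /= ltnS leqn0 => /eqP -> xL; rewrite mulr0n add0r mulr1.
by apply/eqP; apply/negPn/negP => /fL.
Qed.

Lemma cleaningE (alpha : X -> X -> R) f : (forall x y, 0 <= alpha x y) ->
  unit_valued f -> cleaning alpha f = cloud_mx alpha (cleaning_cloud f).
Proof.
move=> alpha0 f01.
have f0 x : 0 <= f x by case/andP: (f01 x).
have f1 x : 0 <= 1 - f x by rewrite subr_ge0; case/andP: (f01 x).
rewrite /cleaning (emx_diag_cloud _ alpha0 _ f1) (emx_diag_cloud _ alpha0 _ f0) emx_of_cloud//.
rewrite (cloud_mx_conv _ alpha0 _ _ (cdiag_ge0 _ f0) cstep_ge0).
apply/funext => x; apply/funext => y; rewrite /emx_add /cloud_mx -esumD.
- by apply: eq_esum => eta _; rewrite -EFinD -mulrDl.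
- by move=> eta _; rewrite lee_fin mulr_ge0 ?cdiag_ge0 ?path_weight_ge0.
- move=> eta _; rewrite lee_fin mulr_ge0 ?path_weight_ge0//.
  by apply: cconv_ge0; [exact: cdiag_ge0|exact: cstep_ge0].
Qed.

Definition cleaning_prod_cloud m (f : 'I_m -> X -> R) : cloud R X :=
  \big[cconv/cdiag (fun=> 1)]_(i < m) cleaning_cloud (f i).

Lemma cleaning_prod_cloud1 f : cleaning_prod_cloud 1 (fun=> f) = cleaning_cloud f.
Proof. by rewrite /cleaning_prod_cloud big_ord_recl big_ord0 cconv1r. Qed.

Lemma cleaning_prod_cloud0 m (f : 'I_m -> X -> R) x :
  cleaning_prod_cloud m f (x, [::]) = \prod_(i < m) (1 - f i x).
Proof.
rewrite /cleaning_prod_cloud.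
apply: (big_rec2 (fun (nu : cloud R X) r => nu (x, [::]) = r)) => // i nu r _ <-.
by rewrite cconv_nil cleaning_cloud0.
Qed.

Lemma cleaning_prod_cloud_stopping m (f : 'I_m -> X -> R) :
  (forall i, unit_valued (f i)) -> exists N, stopping N (cleaning_prod_cloud m f).
Proof.
move=> f01; apply: (big_rec (fun nu : cloud R X => exists N, stopping N nu)).
  by exists 0%N; exact: stopping_one.
move=> i nu _ [N nuN].
by exists (1 + N)%N; apply: stopping_conv nuN; exact: cleaning_cloud_stopping.
Qed.

Lemma cleaning_prod_cloud_carried Lambda m (f : 'I_m -> X -> R) :
  (forall i, fsupp (f i) `<=` Lambda) -> carried_by Lambda (cleaning_prod_cloud m f).
Proof.
move=> fL; apply: (big_rec (carried_by Lambda)) => [|i nu _ nuL].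
  by move=> [x [|y s]] [] //; rewrite /cdiag.
by apply: carried_conv => //; exact: cleaning_cloud_carried.
Qed.

Lemma cleaning_prodE (alpha : X -> X -> R) m (f : 'I_m -> X -> R) :
  (forall x y, 0 <= alpha x y) -> (forall i, unit_valued (f i)) ->
  cleaning_prod alpha f = cloud_mx alpha (cleaning_prod_cloud m f).
Proof.
move=> alpha0 f01; rewrite /cleaning_prod /cleaning_prod_cloud.
suff [] : cloud_ge0 (\big[cconv/cdiag (fun=> 1)]_(i < m) cleaning_cloud (f i)) /\
  \big[@emx_mul R X/@emx_one R X]_(i < m) cleaning alpha (f i) =
  cloud_mx alpha (\big[cconv/cdiag (fun=> 1)]_(i < m) cleaning_cloud (f i)) by [].
apply: (big_rec2 (fun nu A => cloud_ge0 nu /\ A = cloud_mx alpha nu)).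
  by split; [exact: cdiag_ge0|exact: emx_one_cloud].
move=> i nu A _ [nu0 ->]; have [c0 _ _] := cleaning_cloud_stopping _ (f01 i).
by split; [exact: cconv_ge0|rewrite cleaningE// cloud_mx_conv].
Qed.

End StoppingClouds.

(** * The conditions *)

Section Conditions.
Context {R : realType} {X : countType} (Lambda : set X) (c w : X -> R).
Context (alpha : X -> X -> R).
Context (c_ge0 : forall x, 0 <= c x).
Context (w_ge0 : forall x, 0 <= w x).
Context (alpha_ge0 : forall x y, 0 <= alpha x y).

Lemma a_implies_d : cond_a Lambda c w alpha -> cond_d Lambda c w alpha.
Proof.
move=> fin nu nu0 nuL nu1 [eps e0 nue].
(* The given eps may exceed 1 when Lambda is empty. *)
apply: (@neumann_cloud_fin _ _ Lambda c w alpha c_ge0 w_ge0 alpha_ge0 nu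
  (Num.min eps 1)) => //.
- move=> eta; rewrite -lee_fin; apply: le_trans nu1.
  apply: ereal_sup_ubound; exists eta => //; congr (_%:E).
  by apply: eq_bigr => j _; rewrite ger0_norm.
- by rewrite lt_min e0 ltr01 ge_min lexx orbT.
- move=> x /nue nux; apply: (le_trans nux).
  by rewrite lerD2l lerN2 ge_min lexx.
Qed.

Lemma stopping_norm_le1 N (nu : cloud R X) : stopping N nu -> (cloud_norm nu <= 1)%E.
Proof.
move=> nuN; apply: ge_ereal_sup => _ [eta _ <-]; rewrite lee_fin.
apply: le_trans (stopping_le1 _ _ eta nuN); apply: ler_sum => j _.
by case: nuN => nu0 _ _; rewrite ger0_norm.
Qed.

Lemma d_implies_b : cond_d Lambda c w alpha -> cond_b Lambda c w alpha.
Proof.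
move=> d h h01 hL [eps e0 he]; rewrite (cleaningE _ _ alpha_ge0 h01).
have hN := cleaning_cloud_stopping _ h01; have [h0 _ _] := hN.
apply: d => //.
- by apply: cleaning_cloud_carried; rewrite hL.
- exact: stopping_norm_le1 hN.
- exists eps => // x Lx; rewrite cleaning_cloud0 lerD2l lerN2.
  by have := he x; rewrite indicE mem_set// mulr1.
Qed.

(** The cloud of the product stays at x with probability p, the product of the
1 - f_i(x).  As p is at most each factor, m p <= m - eps; adding p <= 1 gives
(m + 1) p <= m + 1 - eps, a bound that also makes sense when m = 0. *)
Lemma d_implies_c : cond_d Lambda c w alpha -> cond_c Lambda c w alpha.
Proof.
move=> d m f f01 fL [eps e0 fe]; rewrite (cleaning_prodE _ _ _ alpha_ge0 f01).
have [N fN] := cleaning_prod_cloud_stopping _ _ f01; have [f0 _ _] := fN.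
apply: d => //.
- exact: cleaning_prod_cloud_carried.
- exact: stopping_norm_le1 fN.
- exists (eps / m.+1%:R) => [|x Lx]; first by rewrite divr_gt0.
  rewrite cleaning_prod_cloud0; set p := \prod_(i < m) _.
  have i01 i : 0 <= 1 - f i x <= 1.
    by have /andP[? ?] := f01 i x; apply/andP; split; lra.
  have p1 : p <= 1 by apply: Num.Theory.prodr_ile1 => i _; exact: i01.
  have pi i : p <= 1 - f i x.
    rewrite /p (bigD1 i)//= ler_piMr//; first by case/andP: (i01 i).
    by apply: Num.Theory.prodr_ile1 => j _; exact: i01.
  have : \sum_(i < m) p <= \sum_(i < m) (1 - f i x) by exact: ler_sum.
  rewrite sumr_const sumrB sumr_const card_ord => le.
  have := fe x; rewrite indicE mem_set// mulr1 => ge.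
  rewrite lerBrDr -lerBrDl ler_pdivrMr// -natr1 mulrDr mulr1.
  by move: le; rewrite -mulr_natr mulrBl mul1r; lra.
Qed.

Lemma indic_unit_valued : unit_valued (\1_Lambda : X -> R).
Proof. by move=> x; rewrite indic_ge0 indic_le1. Qed.

Lemma fsupp_indic : fsupp (\1_Lambda : X -> R) = Lambda.
Proof.
apply/seteqP; split=> x; rewrite /fsupp /= indicE.
  by have [/set_mem//|] := boolP (x \in Lambda); rewrite eqxx.
by move=> /mem_set ->; rewrite oner_eq0.
Qed.

Lemma b_implies_b' : cond_b Lambda c w alpha -> cond_b' Lambda c w alpha.
Proof.
move=> b; exists \1_Lambda; split; [exact: indic_unit_valued|exact: fsupp_indic|].
apply: b; [exact: indic_unit_valued|exact: fsupp_indic|].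
by exists 1 => // x; rewrite mul1r.
Qed.

Lemma b'_implies_a : cond_b' Lambda c w alpha -> cond_a Lambda c w alpha.
Proof.
move=> [h [h01 hL]]; rewrite (cleaningE _ _ alpha_ge0 h01) => fin.
have [h0 _ h1] := cleaning_cloud_stopping _ h01.
apply: (@alpha_neumann_fin _ _ Lambda c w alpha c_ge0 w_ge0 alpha_ge0 _ 1 (fun=> 1)) => //.
- by apply: cleaning_cloud_carried; rewrite hL.
- move=> x; rewrite -hL cleaning_cloud0 /fsupp /= => hx.
  by rewrite ltrBlDr ltrDl lt_neqAle eq_sym hx; case/andP: (h01 x).
- by move=> [|j]// b _ b0; rewrite cconv1r mul1e.
Qed.

Lemma c_implies_b : cond_c Lambda c w alpha -> cond_b Lambda c w alpha.
Proof.
move=> C h h01 hL [eps e0 he].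
have := C 1%N (fun=> h) (fun=> h01); rewrite (cleaning_prodE _ _ _ alpha_ge0 (fun=> h01)).
rewrite cleaning_prod_cloud1 -(cleaningE _ _ alpha_ge0 h01).
apply; first by move=> _; rewrite hL.
by exists eps => // x; rewrite big_ord1.
Qed.

Lemma c_implies_c' : cond_c Lambda c w alpha -> cond_c' Lambda c w alpha.
Proof.
move=> C; exists 1%N, (fun=> \1_Lambda); split => [_|_|].
- exact: indic_unit_valued.
- by rewrite fsupp_indic.
- apply: C => [_|_|]; [exact: indic_unit_valued|by rewrite fsupp_indic|].
  by exists 1 => // x; rewrite big_ord1 mul1r.
Qed.

Lemma c'_implies_d' : cond_c' Lambda c w alpha -> cond_d' Lambda c w alpha.
Proof.
move=> [m [f [f01 fL]]]; rewrite (cleaning_prodE _ _ _ alpha_ge0 f01) => fin.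
have [N fN] := cleaning_prod_cloud_stopping _ _ f01; have [_ fv _] := fN.
exists (cleaning_prod_cloud m f); split => //.
- exact: stopping_S1 fN.
- exact: cleaning_prod_cloud_carried.
- by exists N.
Qed.

Lemma d'_implies_a (C : R) :
  (forall x, Lambda x -> 0 < c x) -> (forall x, Lambda x -> 0 < w x) ->
  (forall x, (emx_col (emx_restrict Lambda (emx_of alpha)) w x <= (C * w x)%:E)%E) ->
  cond_d' Lambda c w alpha -> cond_a Lambda c w alpha.
Proof.
move=> cL wL Cw [nu [nuS nuL [N nuN] fin]].
(* Widening to N + 1 covers N = 0, where the window would be empty. *)
have [nu0 _ nu1] := stopping_widen _ _ _ (leqnSn N) (S1_stopping _ _ nuS nuN).
(* The absolute value covers the case of a negative C. *)
apply: (@alpha_neumann_fin _ _ Lambda c w alpha c_ge0 w_ge0 alpha_ge0 nu N.+1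
  (fun j => `|C| ^+ j)) => //.
- move=> x Lx; apply: (@cloud_at_point_lt1 _ _ Lambda c w alpha) => //; [exact: cL|exact: wL].
- move=> j b _ b0; apply: cloud_value_inner_step => // x.
  by apply: (le_trans (Cw x)); rewrite lee_fin ler_wpM2r// ler_norm.
Qed.

End Conditions.

Theorem theorem6p1 (R : realType) (X : countType) (hX : [set: X] !=set0)
    (Lambda : set X) (c w : X -> R)
    (hc : forall x, 0 <= c x) (hw : forall x, 0 <= w x)
    (hcL : forall x, Lambda x -> 0 < c x)
    (hwL : forall x, Lambda x -> 0 < w x)
    (alpha : X -> X -> R) (halpha : forall x y, 0 <= alpha x y) :
  [/\ [<-> cond_a Lambda c w alpha;
           cond_b Lambda c w alpha;
           cond_b' Lambda c w alpha;
           cond_c Lambda c w alpha;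
           cond_d Lambda c w alpha],
      cond_d Lambda c w alpha -> cond_c' Lambda c w alpha,
      cond_c' Lambda c w alpha -> cond_d' Lambda c w alpha &
      (exists C : R, forall x,
         (emx_col (emx_restrict Lambda (emx_of alpha)) w x <= (C * w x)%:E)%E) ->
      [<-> cond_a Lambda c w alpha;
           cond_b Lambda c w alpha;
           cond_b' Lambda c w alpha;
           cond_c Lambda c w alpha;
           cond_d Lambda c w alpha;
           cond_c' Lambda c w alpha;
           cond_d' Lambda c w alpha]].
Proof.
have ad : cond_a Lambda c w alpha -> cond_d Lambda c w alpha by exact: a_implies_d.
have db : cond_d Lambda c w alpha -> cond_b Lambda c w alpha by exact: d_implies_b.
have dc : cond_d Lambda c w alpha -> cond_c Lambda c w alpha by exact: d_implies_c.
have bb' : cond_b Lambda c w alpha -> cond_b' Lambda c w alpha by exact: b_implies_b'.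
have b'a : cond_b' Lambda c w alpha -> cond_a Lambda c w alpha by exact: b'_implies_a.
have cb : cond_c Lambda c w alpha -> cond_b Lambda c w alpha by exact: c_implies_b.
have dc' : cond_d Lambda c w alpha -> cond_c' Lambda c w alpha.
  by move=> /dc; exact: c_implies_c'.
have c'd' : cond_c' Lambda c w alpha -> cond_d' Lambda c w alpha.
  exact: c'_implies_d'.
split=> //; first by tfae; tauto.
move=> [C Cw].
have d'a : cond_d' Lambda c w alpha -> cond_a Lambda c w alpha.
  exact: d'_implies_a hcL hwL Cw.
by tfae; tauto.
Qed.
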